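(* Let $(\Omega,\mathcal{F},\mathbb{P})$ be a probability space and $\{\mathcal{F}_t\}_{t\in\mathbb{R}_+}$ a filtration (not assumed to satisfy the usual conditions) with $\bigvee_{t\in\mathbb{R}_+}\mathcal{F}_t\subseteq\mathcal{F}$. For every optional set $O\subseteq\Omega\times\mathbb{R}_+$ and every $\epsilon>0$ there exists an optional time $\tau^{O,\epsilon}$ such that $[\![\tau^{O,\epsilon}]\!]\subseteq O$ and $$\mathbb{P}^*\left(\pi_\Omega(O)\right)-\mathbb{P}\left(\{\tau^{O,\epsilon}<\infty\}\right)\leq\epsilon .$$
   Context: $\mathbb{R}_+=[0,\infty)$. No completeness or right-continuity of the filtration is assumed. An optional time (stopping time) is a function $\tau:\Omega\to\mathbb{R}_+\cup\{\infty\}$ with $\{\tau\le t\}\in\mathcal{F}_t$ for all $t\in\mathbb{R}_+$. For a function $\tau:\Omega\to\mathbb{R}_+\cup\{\infty\}$, its graph is $[\![\tau]\!]=\{(\omega,\tau(\omega)):\omega\in\Omega,\ \tau(\omega)<\infty\}$, and $[\![\tau,\infty[\![=\{(\omega,t)\in\Omega\times\mathbb{R}_+:\tau(\omega)\le t\}$. The optional $\sigma$-algebra on $\Omega\times\mathbb{R}_+$ is the $\sigma$-algebra generated by the sets $[\![\tau,\infty[\![$ with $\tau$ an optional time; its elements are the optional sets. $\pi_\Omega:\Omega\times\mathbb{R}_+\to\Omega$ is the projection $\pi_\Omega(\omega,t)=\omega$. For $A\subseteq\Omega$, $\mathbb{P}^*(A)=\inf\{\mathbb{P}(E):A\subseteq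 E,\ E\in\mathcal{F}\}$. *)

(* Defs.v *)
From mathcomp Require Import all_boot all_order all_algebra.
From mathcomp Require Import all_classical all_reals all_analysis.

Set Implicit Arguments.
Unset Strict Implicit.
Unset Printing Implicit Defensive.

Import Order.TTheory GRing.Theory Num.Theory.
Import numFieldNormedType.Exports.

Local Open Scope classical_set_scope.
Local Open Scope ring_scope.
Local Open Scope ereal_scope.

(* The time set [0, +oo[ is the subtype {nonneg R}; neither completeness nor
   right-continuity is required of a filtration. *)
Definition is_filtration (R : realType) (T : Type)
    (F : {nonneg R} -> set (set T)) : Prop :=
  (forall t, sigma_algebra [set: T] (F t)) /\
  (forall s t : {nonneg R}, (s <= t)%R -> F s `<=` F t).

(* Functions with values in [0, +oo] are functions into \bar R with
   nonnegative values. *)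
Definition optional_time (R : realType) (T : Type)
    (F : {nonneg R} -> set (set T)) (tau : T -> \bar R) : Prop :=
  (forall w, 0 <= tau w) /\
  (forall t : {nonneg R}, F t [set w | tau w <= (t%:num)%:E]).

Definition graph_of_time (R : realType) (T : Type) (tau : T -> \bar R) :
    set (T * {nonneg R}) :=
  [set p | tau p.1 = (p.2%:num)%:E].

(* [[tau, +oo[[ *)
Definition stochastic_interval (R : realType) (T : Type) (tau : T -> \bar R) :
    set (T * {nonneg R}) :=
  [set p | tau p.1 <= (p.2%:num)%:E].

Definition optional_sigma_algebra (R : realType) (T : Type)
    (F : {nonneg R} -> set (set T)) : set (set (T * {nonneg R})) :=
  <<s [set stochastic_interval tau | tau in optional_time F] >>.

Definition outer_probability (R : realType) (d : measure_display)
    (T : measurableType d) (P : probability T R) (A : set T) : \bar R :=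
  ereal_inf [set P E | E in [set E | A `<=` E /\ measurable E]].

(* Main.v *)
Require Import Defs.
From mathcomp Require Import all_boot all_order all_algebra.
From mathcomp Require Import all_classical all_reals all_analysis.
From mathcomp Require Import zify.

(** Choquet's capacitability theorem is behind this, but it must be run on two
    pavings at once.  To make the projection to the sample space behave well
    under decreasing intersections one wants sets with compact sections, and
    those are not tied to the filtration.  To make debuts optional times one
    wants finite unions of intervals [[sigma, tau[[, and those are not compact.

    So an optional set [O] is written as a union over sequences [s] of naturals
    of intersections [\bigcap_k G k s], with each [G k s] of the compact kind;
    and [\bigcap_k G k s] is inside [\bigcap_k H k s], itself inside [O], with
    each [H k s] a finite union of intervals.  Such pairs of
    schemes exist for the generators and their complements, and are stable under
    countable unions and intersections, hence exist for all optional sets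
    ([optional_souslin]).

    The outer probability of the projection is continuous along increasing
    unions ([outer_probability_bigcup]), so the branches can be bounded, level
    by level, by some [m] with a loss of at most [eps] ([capacitability]).  By
    König's lemma ([bigcap_bounded_hull]) the bounded parts of the two schemes
    are decreasing intersections of finite unions: [Y] with compact sections,
    [X] elementary, and [\bigcap_n Y n] is inside [\bigcap_n X n], which is
    inside [O].  Compactness gives the projection of [\bigcap_n Y n], and a
    fortiori that of [\bigcap_n X n], almost the full outer probability.

    There remains to find an optional time whose graph lies in
    [\bigcap_n X n] and that is finite almost everywhere on its projection
    ([elementary_bigcap_section]).  Without the usual conditions the debut of
    this set need not be optional, so the essential supremum [tau] of the
    optional times that precede the set is used instead.  The debut of each
    [X n] after [tau] is optional, is attained, and still precedes the set, so
    it equals [tau] almost surely.  The exceptional event need not be in any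
    [F t], but its part where [tau <= t] is in [F t]; this is enough to send
    [tau] to infinity there, which puts its graph exactly inside the set. *)

Set Implicit Arguments.
Unset Strict Implicit.
Unset Printing Implicit Defensive.

Import Order.TTheory GRing.Theory Num.Theory.
Import numFieldNormedType.Exports.

Local Open Scope classical_set_scope.
Local Open Scope ring_scope.
Local Open Scope ereal_scope.

(** * Souslin schemes *)

(** A Souslin scheme is indexed here by whole sequences, each level being
    allowed to look at finitely many terms only.  This avoids finite sequences
    and makes recoding of indices a mere precomposition. *)
Definition nonanticipating (T : Type) (G : nat -> (nat -> nat) -> set T) :=
  forall k s s', (forall i, (i <= k)%N -> s i = s' i) -> G k s = G k s'.

Definition scheme (T : Type) (K : set (set T))
    (G : nat -> (nat -> nat) -> set T) :=
  nonanticipating G /\ forall k s, K (G k s).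

(** Two schemes with a common kernel [O], the [K]-scheme lying inside the
    [A]-scheme branch by branch: whatever set of branches is later selected,
    the part of [O] that the [K]-scheme yields stays inside the part that the
    [A]-scheme yields for the same branches. *)
Definition souslin_pair (T : Type) (K A : set (set T)) (O : set T) :=
  exists G H, [/\ scheme K G, scheme A H,
    forall s, \bigcap_k G k s `<=` \bigcap_k H k s,
    O `<=` \bigcup_s \bigcap_k G k s &
    \bigcup_s \bigcap_k H k s `<=` O].

Lemma souslin_pair_paving (T : Type) (K : set (set T)) (X : set T) :
  K X -> souslin_pair K setT X.
Proof.
move=> KX; exists (fun _ _ => X), (fun _ _ => X); split => //.
- by move=> s x Xx.
- by move=> x Xx; exists (fun=> 0%N) => // k _.
- by move=> x [s _ Xx]; exact: (Xx 0%N I).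
Qed.

(** The trivial outer paving [setT] lets the inner schemes be built freely;
    once the kernel is known to be in [A], it serves as its own outer scheme. *)
Lemma souslin_pair_outer (T : Type) (K A : set (set T)) (X : set T) :
  A X -> souslin_pair K setT X -> souslin_pair K A X.
Proof.
move=> AX [G [H [sG sH GH XG HX]]]; exists G, (fun _ _ => X); split => //.
- move=> s x Gx k _; apply: HX; exists s => //; exact: GH.
- by move=> x [s _ Xx]; exact: (Xx 0%N I).
Qed.

(** Every term of a sequence is read as a pair; the first component of the
    first term selects the set, and the second components run its scheme. *)
Lemma souslin_pair_bigcup (T : Type) (K A : set (set T)) (X : nat -> set T) :
  (forall n, souslin_pair K A (X n)) -> souslin_pair K A (\bigcup_n X n).
Proof.
move=> /choice[G] /choice[H] GHP.
pose dec m : nat * nat := odflt (0, 0)%N (unpickle m).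
have decK p : dec (pickle p) = p by rewrite /dec pickleK.
pose tl (s : nat -> nat) i := (dec (s i)).2.
exists (fun k s => G (dec (s 0%N)).1 k (tl s)).
exists (fun k s => H (dec (s 0%N)).1 k (tl s)).
split.
- split=> [k s s' ss'|k s]; last by have [[]] := GHP (dec (s 0%N)).1.
  rewrite ss'//; have [[+ _] _ _ _ _] := GHP (dec (s' 0%N)).1; apply.
  by move=> i ik; rewrite /tl ss'.
- split=> [k s s' ss'|k s]; last by have [_ []] := GHP (dec (s 0%N)).1.
  rewrite ss'//; have [_ [+ _] _ _ _] := GHP (dec (s' 0%N)).1; apply.
  by move=> i ik; rewrite /tl ss'.
- move=> s; have [_ _ + _ _] := GHP (dec (s 0%N)).1; exact.
- move=> x [n _ Xx]; have [_ _ _ /(_ _ Xx)[s _ Gx] _] := GHP n.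
  exists (fun i => pickle (n, s i)) => // k _; rewrite decK /=.
  have -> : tl (fun i => pickle (n, s i)) = s.
    by apply/funext => i; rewrite /tl decK.
  exact: Gx.
- move=> x [s _ Hx]; exists (dec (s 0%N)).1 => //.
  have [_ _ _ _] := GHP (dec (s 0%N)).1; apply; exists (tl s) => //.
Qed.

(** A pairing that is monotone in its second argument lets one sequence carry
    countably many: the terms of index at most [j] of the [n]-th one are read at
    indices at most [pairing n j]. *)
Definition pairing (n i : nat) : nat := ((n + i) ^ 2 + n)%N.

Lemma pairing_inj n i n' i' : pairing n i = pairing n' i' -> (n, i) = (n', i').
Proof.
rewrite /pairing !expnS !expn0 !muln1 => h.
have [lt|lt|eq] := ltngtP (n + i)%N (n' + i')%N.
- have : ((n + i).+1 * (n + i).+1 <= (n' + i') * (n' + i'))%N.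
    exact: leq_mul.
  lia.
- have : ((n' + i').+1 * (n' + i').+1 <= (n + i) * (n + i))%N.
    exact: leq_mul.
  lia.
- by rewrite eq in h; congr pair; lia.
Qed.

Lemma pairing_mono n i j : (i <= j)%N -> (pairing n i <= pairing n j)%N.
Proof. by move=> ij; rewrite /pairing leq_add2r leq_exp2r// leq_add2l. Qed.

(** Indices [k] outside the range of the pairing are sent to [(0, 0)], which is
    harmless as [pairing 0 0 = 0]. *)
Lemma pairing_inverse : exists dec : nat -> nat * nat,
  (forall n i, dec (pairing n i) = (n, i)) /\
  (forall k, (pairing (dec k).1 (dec k).2 <= k)%N).
Proof.
have /choice[dec decP] k : exists p : nat * nat,
    (pairing p.1 p.2 <= k)%N /\ forall n i, pairing n i = k -> p = (n, i).
  have [[n [i eq_k]]|nk] := pselect (exists n i, pairing n i = k).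
    exists (n, i); split=> [|n' i' eq_k']; first by rewrite eq_k.
    by apply: pairing_inj; rewrite eq_k.
  by exists (0, 0)%N; split=> // n i eq_k; case: nk; exists n, i.
exists dec; split=> [n i|k]; last by have [] := decP k.
by have [_] := decP (pairing n i); apply.
Qed.

(** One sequence codes a branch for each of the sets, and level [pairing n j]
    checks level [j] of the [n]-th scheme. *)
Lemma souslin_pair_bigcap (T : Type) (K A : set (set T)) (X : nat -> set T) :
  (forall n, souslin_pair K A (X n)) -> souslin_pair K A (\bigcap_n X n).
Proof.
move=> /choice[G] /choice[H] GHP.
have [dec [decK dec_le]] := pairing_inverse.
pose sub n (s : nat -> nat) i := s (pairing n i).
have subP k s s' : (forall i, (i <= k)%N -> s i = s' i) ->
    forall i, (i <= (dec k).2)%N -> sub (dec k).1 s i = sub (dec k).1 s' i.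
  move=> ss' i ik; apply: ss'; apply: leq_trans (dec_le k).
  exact: pairing_mono.
exists (fun k s => G (dec k).1 (dec k).2 (sub (dec k).1 s)).
exists (fun k s => H (dec k).1 (dec k).2 (sub (dec k).1 s)).
split.
- split=> [k s s' ss'|k s]; last by have [[]] := GHP (dec k).1.
  by have [[+ _] _ _ _ _] := GHP (dec k).1; apply; exact: subP.
- split=> [k s s' ss'|k s]; last by have [_ []] := GHP (dec k).1.
  by have [_ [+ _] _ _ _] := GHP (dec k).1; apply; exact: subP.
- move=> s x Gx k _; have [_ _ + _ _] := GHP (dec k).1; apply => // j _.
  by have := Gx (pairing (dec k).1 j) I; rewrite decK.
- move=> x Xx.
  have /choice[s sP] n : exists s, (\bigcap_k G n k s) x.
    by have [_ _ _ /(_ _ (Xx n I))[s _ Gx] _] := GHP n; exists s.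
  exists (fun k => s (dec k).1 (dec k).2) => // k _.
  have -> : sub (dec k).1 (fun k => s (dec k).1 (dec k).2) = s (dec k).1.
    by apply/funext => i; rewrite /sub decK.
  exact: sP.
- move=> x [s _ Hx] n _; have [_ _ _ _] := GHP n; apply.
  exists (sub n s) => // k _.
  by have := Hx (pairing n k) I; rewrite decK.
Qed.

(** * Capacitability *)

(** Only the terms [s 0], ..., [s n] matter, so that this is a finite union of
    finite intersections of members of the scheme. *)
Definition bounded_hull (T : Type) (G : nat -> (nat -> nat) -> set T)
    (m : nat -> nat) (n : nat) : set T :=
  [set x | exists2 s, (forall i, (s i <= m i)%N) &
    forall k, (k <= n)%N -> G k s x].

Section hull.
Variables (T : Type) (K : set (set T)).
Hypothesis KU : forall X Y, K X -> K Y -> K (X `|` Y).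
Hypothesis KI : forall X Y, K X -> K Y -> K (X `&` Y).

(** Induction on the number of relevant terms, the last of them being absorbed
    in a finite union over its [(m n).+1] possible values. *)
Lemma paving_finite_branching (m : nat -> nat) n (X : (nat -> nat) -> set T) :
  (forall s s', (forall i, (i < n)%N -> s i = s' i) -> X s = X s') ->
  (forall s, K (X s)) ->
  K [set x | exists2 s, (forall i, (s i <= m i)%N) & X s x].
Proof.
elim: n X => [|n IH] X locX KX.
  rewrite (_ : [set _ | _] = X (fun=> 0%N))//; apply/seteqP; split => x /=.
    by case=> s _ Xx; rewrite (locX _ s).
  by move=> Xx; exists (fun=> 0%N).
pose upd (s : nat -> nat) v i := if i == n then v else s i.
have KU_fin M (Y : nat -> set T) : (forall v, K (Y v)) ->
    K [set x | exists2 v, (v <= M)%N & Y v x].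
  move=> KY; elim: M => [|M IHM].
    rewrite (_ : [set _ | _] = Y 0%N)//; apply/seteqP; split => x /=.
      by case=> v; rewrite leqn0 => /eqP ->.
    by move=> ?; exists 0%N.
  have := KU IHM (KY M.+1); congr K; apply/seteqP; split => x /=.
    by case=> [[v vM Yx]|Yx]; [exists v => //; exact: leqW|exists M.+1].
  case=> v; rewrite leq_eqVlt => /predU1P[->|vM] Yx; first by right.
  by left; exists v.
pose Y s := [set x | exists2 v, (v <= m n)%N & X (upd s v) x].
have locY s s' : (forall i, (i < n)%N -> s i = s' i) -> Y s = Y s'.
  move=> ss'; have E v : X (upd s v) = X (upd s' v).
    apply: locX => i; rewrite ltnS leq_eqVlt /upd => /predU1P[->|ni].
      by rewrite eqxx.
    by case: eqP => // _; exact: ss'.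
  by apply/seteqP; split=> x [v vm Xx]; exists v => //; [rewrite -E|rewrite E].
have := IH Y locY (fun s => KU_fin (m n) (fun v => X (upd s v)) (fun v => KX _)).
congr K; apply/seteqP; split=> x /=.
  case=> s sm [v vm Xx]; exists (upd s v) => // i; rewrite /upd.
  by case: eqP => [->|].
case=> s sm Xx; exists s => //; exists (s n) => //; rewrite (_ : upd _ _ = s)//.
by apply/funext => i; rewrite /upd; case: eqP => // ->.
Qed.

Lemma bounded_hull_paving G m n : scheme K G -> K (bounded_hull G m n).
Proof.
move=> [naG KG].
apply: (@paving_finite_branching m n.+1
  (fun s => [set x | forall k, (k <= n)%N -> G k s x])).
  move=> s s' ss'; suff E k : (k <= n)%N -> G k s = G k s'.
    by apply/seteqP; split=> x h k kn; move: (h k kn); rewrite E.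
  by move=> kn; apply: naG => i ik; apply: ss'; rewrite ltnS (leq_trans ik).
move=> s; elim: n => [|n IH].
  rewrite (_ : [set _ | _] = G 0%N s)//; apply/seteqP; split => x /=; first exact.
  by move=> h k; rewrite leqn0 => /eqP ->.
have := KI IH (KG n.+1 s); congr K; apply/seteqP; split => x /=.
  by case=> h hn k; rewrite leq_eqVlt => /predU1P[->//|]; exact: h.
by move=> h; split=> [k kn|]; apply: h => //; exact: leqW.
Qed.

End hull.

Lemma bounded_hull_decr (T : Type) (G : nat -> (nat -> nat) -> set T) m n p :
  (n <= p)%N -> bounded_hull G m p `<=` bounded_hull G m n.
Proof.
by move=> np x [s sm Gx]; exists s => // k kn; apply: Gx; exact: leq_trans np.
Qed.

(** König's lemma for the tree of branches bounded by [m]: the empty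
    prefix is extended by survivors of every level, and whenever a prefix is,
    so is one of its finitely many one-step extensions. *)
Lemma bigcap_bounded_hull (T : Type) (G : nat -> (nat -> nat) -> set T) m :
  nonanticipating G ->
  \bigcap_n bounded_hull G m n `<=`
    [set x | exists2 s, (forall i, (s i <= m i)%N) & (\bigcap_k G k s) x].
Proof.
move=> naG x hx.
(* In a pair [p], only the first [p.1] terms of the sequence [p.2] matter. *)
pose good (p : nat * (nat -> nat)) := forall N, exists s,
  [/\ forall i, (s i <= m i)%N, forall i, (i < p.1)%N -> s i = p.2 i &
      forall k, (k <= N)%N -> G k s x].
pose upd (p : nat * (nat -> nat)) v i := if i == p.1 then v else p.2 i.
have ext p : good p -> exists v, good (p.1.+1, upd p v).
  move=> gp; apply: contrapT => /forallNP bad.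
  have /choice[N NP] v : exists N, forall s, (forall i, (s i <= m i)%N) ->
      (forall i, (i < p.1.+1)%N -> s i = upd p v i) ->
      ~ (forall k, (k <= N)%N -> G k s x).
    have /existsNP[N NP] := bad v; exists N => s sm sp sx.
    by apply: NP; exists s.
  pose M := (\max_(v < (m p.1).+1) N v)%N.
  have [s [sm sp sx]] := gp M.
  apply: (NP (s p.1) s) => // [i|k kN].
    rewrite ltnS leq_eqVlt /upd => /predU1P[->|ip]; first by rewrite eqxx.
    by rewrite ltn_eqF// sp.
  apply: sx; apply: leq_trans kN _.
  have sv : (s p.1 < (m p.1).+1)%N by rewrite ltnS.
  exact: (@leq_bigmax _ (fun v : 'I_(m p.1).+1 => N v) (Ordinal sv)).
have /choice[nxt nxtP] : forall p, exists v, good p -> good (p.1.+1, upd p v).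
  move=> p; have [gp|] := pselect (good p); last by exists 0%N.
  by have [v gv] := ext p gp; exists v.
pose step p : nat * (nat -> nat) := (p.1.+1, upd p (nxt p)).
pose P n := iter n step (0%N, fun=> 0%N).
have P1 n : (P n).1 = n by elim: n => //= n ->.
have gP n : good (P n).
  elim: n => [N|n IH]; last exact: nxtP.
  by have [s sm sx] := hx N I; exists s.
have stable n i j : (i < n)%N -> (n <= j)%N -> (P j).2 i = (P n).2 i.
  move=> ni; elim: j => [|j IH]; first by rewrite leqn0 => /eqP ->.
  rewrite leq_eqVlt => /predU1P[->//|nj]; rewrite -IH//=.
  by rewrite /upd P1 ltn_eqF//; exact: leq_trans ni _.
pose s i := (P i.+1).2 i.
have agree n i : (i < n)%N -> (P n).2 i = s i by move=> ni; exact: stable.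
exists s => [i|k _].
  have [s' [s'm s'P _]] := gP i.+1 0%N.
  by rewrite -(agree i.+1)// -s'P ?P1.
have [s' [_ s'P s'x]] := gP k.+1 k.
rewrite (naG _ _ s'); first exact: s'x.
by move=> i ik; rewrite s'P ?P1// agree.
Qed.

(** Choquet's argument, where [Big] says that a capacity exceeds a threshold.
    As the bound on one more term grows, the kernel increases to what it was
    before that term was bounded; so the bounds can be chosen one at a time
    while keeping the capacity above the threshold. *)
Lemma capacitability (T : Type) (Big : set (set T))
    (G : nat -> (nat -> nat) -> set T) :
  nonanticipating G ->
  (forall X Y, X `<=` Y -> Big X -> Big Y) ->
  (forall X : nat -> set T, (forall n p, (n <= p)%N -> X n `<=` X p) ->
     Big (\bigcup_n X n) -> exists n, Big (X n)) ->
  Big (\bigcup_s \bigcap_k G k s) ->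
  exists m, forall n, Big (bounded_hull G m n).
Proof.
move=> naG bigS bigU bigG.
pose kernel (S : set (nat -> nat)) := \bigcup_(s in S) \bigcap_k G k s.
pose cut (p : nat * set (nat -> nat)) j := p.2 `&` [set s | (s p.1 <= j)%N].
have /choice[pick pickP] : forall p, exists j,
    Big (kernel p.2) -> Big (kernel (cut p j)).
  move=> p; have [bp|] := pselect (Big (kernel p.2)); last by exists 0%N.
  have [||j bj] := bigU (fun j => kernel (cut p j)); last by exists j.
    move=> n q nq x [s [sp sn] Gx]; exists s => //; split => //.
    exact: leq_trans nq.
  apply: bigS bp => x [s sp Gx]; exists (s p.1) => //; exists s => //.
  by split => /=.
pose step p := (p.1.+1, cut p (pick p)).
pose P n := iter n step (0%N, setT).
have P1 n : (P n).1 = n by elim: n => //= n ->.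
pose m n := pick (P n).
have bP n : Big (kernel (P n).2).
  by elim: n => [|n IH]; [exact: bigG|exact: pickP].
have Pm n s : (P n).2 s -> forall i, (i < n)%N -> (s i <= m i)%N.
  elim: n => // n IH /= -[/IH h] /=; rewrite P1 => sn i.
  by rewrite ltnS leq_eqVlt => /predU1P[->//|]; exact: h.
exists m => n; apply: bigS (bP n.+1) => x [s sP Gx].
(* A branch bounded up to level [n] is made bounded throughout without changing
   the first [n.+1] levels of the scheme. *)
exists (fun i => minn (s i) (m i)) => [i|k kn]; first exact: geq_minr.
rewrite (naG _ _ s); first exact: Gx.
by move=> i ik; apply/minn_idPl; apply: Pm sP _ _; rewrite ltnS (leq_trans ik).
Qed.

(** * Optional times of a filtration *)

Section optional_times.
Variables (R : realType) (T : pointedType) (F : {nonneg R} -> set (set T)).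
Hypothesis filtF : is_filtration F.
Implicit Types (sigma tau S D : T -> \bar R) (t : {nonneg R}).

(** Transfers the closure properties of measurable sets to [F t]. *)
Lemma filtration_measurable t (E : set T) :
  F t E = measurable (E : set (g_sigma_algebraType (F t))).
Proof. by rewrite -[in LHS](sigma_algebra_id (filtF.1 t)). Qed.

(** The absolute value folds an enumeration of the rationals onto the
    nonnegative ones. *)
Definition rational_time (n : nat) : {nonneg R} :=
  (`|ratr (odflt (0 : rat) (unpickle n)) : R|%:nng)%R.

Lemma rational_time_dense (x y : \bar R) : 0 <= x -> x < y ->
  exists n, x <= (rational_time n)%:num%:E < y.
Proof.
have dense (a b : R) : (0 <= a)%R -> (a < b)%R ->
    exists n, (a%:E <= (rational_time n)%:num%:E < b%:E)%E.
  move=> a0 /rat_in_itvoo[q]; rewrite in_itv/= => /andP[aq qb].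
  exists (pickle q); rewrite /rational_time pickleK/= lee_fin lte_fin.
  by rewrite ger0_norm ?(ltW aq) ?qb// (le_trans a0 (ltW aq)).
case: x y => [a| |] [b| |] //=; rewrite ?lte_fin ?lee_fin.
- exact: dense.
- move=> a0 _.
  have [n /andP[an nb]] := dense a (a + 1)%R a0 (ltac:(by rewrite ltrDl)).
  by exists n; rewrite an ltry.
Qed.

Lemma optional_time_cst (x : \bar R) : 0 <= x -> optional_time F (fun=> x).
Proof.
move=> x0; split=> // t; rewrite filtration_measurable.
have [xt|xt] := boolP (x <= t%:num%:E).
  by rewrite (_ : [set _ | _] = setT)//; apply/seteqP; split.
by rewrite (_ : [set _ | _] = set0)//; apply/seteqP; split => //= w; exact/negP.
Qed.

Lemma optional_time_min sigma tau : optional_time F sigma ->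
  optional_time F tau -> optional_time F (fun w => mine (sigma w) (tau w)).
Proof.
move=> [s0 sF] [t0 tF]; split=> [w|t]; first by rewrite le_min s0 t0.
rewrite (_ : [set _ | _] =
    [set w | sigma w <= t%:num%:E] `|` [set w | tau w <= t%:num%:E]).
  move: (sF t) (tF t); rewrite !filtration_measurable; exact: measurableU.
by apply/seteqP; split=> w /=; rewrite ge_min => /orP.
Qed.

Lemma optional_time_sup (S : nat -> T -> \bar R) :
  (forall n, optional_time F (S n)) ->
  optional_time F (fun w => ereal_sup [set S n w | n in setT]).
Proof.
move=> oS; split=> [w|t].
  by apply: (le_trans ((oS 0%N).1 w)); apply: ereal_sup_ubound; exists 0%N.
rewrite (_ : [set _ | _] = \bigcap_n [set w | S n w <= t%:num%:E]).
  rewrite filtration_measurable; apply: bigcap_measurableType => n _.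
  by move: ((oS n).2 t); rewrite filtration_measurable.
apply/seteqP; split=> w /= h.
  by move=> n _ /=; apply: le_trans h; apply: ereal_sup_ubound; exists n.
by apply: ge_ereal_sup => _ [n _ <-]; exact: h.
Qed.

Lemma optional_time_max sigma tau : optional_time F sigma ->
  optional_time F tau -> optional_time F (fun w => maxe (sigma w) (tau w)).
Proof.
move=> [s0 sF] [t0 tF]; split=> [w|t]; first by rewrite le_max s0.
rewrite (_ : [set _ | _] =
    [set w | sigma w <= t%:num%:E] `&` [set w | tau w <= t%:num%:E]).
  move: (sF t) (tF t); rewrite !filtration_measurable; exact: measurableI.
by apply/seteqP; split=> w /=; rewrite ge_max => /andP.
Qed.

(** Either [tau] has not yet come at time [t], or a rational time at which
    [sigma] has come and [tau] has not bears witness to [sigma < tau] by time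
    [t]. *)
Lemma optional_time_lt sigma tau t : optional_time F sigma ->
  optional_time F tau ->
  F t [set w | sigma w < tau w /\ sigma w <= t%:num%:E].
Proof.
move=> [s0 sF] [t0 tF].
have gap q : (q <= t)%R ->
    F t ([set w | sigma w <= q%:num%:E] `\` [set w | tau w <= q%:num%:E]).
  move=> /filtF.2 qt; move: (qt _ (sF q)) (qt _ (tF q)).
  rewrite !filtration_measurable; exact: measurableD.
rewrite (_ : [set _ | _] =
    ([set w | sigma w <= t%:num%:E] `\` [set w | tau w <= t%:num%:E]) `|`
    \bigcup_(n in [set n | (rational_time n <= t)%R])
      ([set w | sigma w <= (rational_time n)%:num%:E] `\`
       [set w | tau w <= (rational_time n)%:num%:E])).
  rewrite filtration_measurable; apply: measurableU.
    by have := gap t (lexx t); rewrite filtration_measurable.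
  by apply: bigcup_measurable => n /= /gap; rewrite filtration_measurable.
apply/seteqP; split=> w /=.
  move=> [st sgt]; have [tt|tt] := boolP (tau w <= t%:num%:E); last first.
    by left; split=> //; exact/negP.
  right; have [n /andP[sn nt]] := rational_time_dense (s0 w) st.
  exists n => /=; last by split=> //; apply/negP; rewrite -ltNge.
  by have := ltW (lt_le_trans nt tt); rewrite lee_fin.
case=> [[st /negP]|[n /= nt [sn /negP]]]; rewrite -ltNge => h.
  by split=> //; exact: le_lt_trans h.
split; first exact: le_lt_trans h.
by apply: le_trans sn _; rewrite lee_fin.
Qed.

(** The event [E] is only required to be known at time [t] where [sigma <= t]:
    this is what allows exceptional events to be discarded although the
    [F t] are not complete. *)
Lemma optional_time_restrict sigma (E : set T) : optional_time F sigma ->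
  (forall t, F t (E `&` [set w | sigma w <= t%:num%:E])) ->
  optional_time F (fun w => if `[< E w >] then sigma w else +oo).
Proof.
move=> [s0 sF] EF; split=> [w|t]; first by case: ifP.
rewrite (_ : [set _ | _] = E `&` [set w | sigma w <= t%:num%:E])//.
apply/seteqP; split=> w /=; first by case: asboolP.
by case=> /asboolP ->.
Qed.

(** * Elementary sets *)

(** Finite unions of intervals [[sigma, tau[[, presented inductively so that
    stability under intersection and the existence of debuts are proved by
    structural induction. *)
Inductive elementary : set (set (T * {nonneg R})) :=
| elementary_itv sigma tau : optional_time F sigma -> optional_time F tau ->
    elementary [set p | sigma p.1 <= p.2%:num%:E < tau p.1]
| elementaryU X Y : elementary X -> elementary Y -> elementary (X `|` Y).

Lemma elementaryI X Y : elementary X -> elementary Y -> elementary (X `&` Y).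
Proof.
move=> eX eY; elim: eX => [sigma tau os ot|A B _ IA _ IB]; last first.
- by rewrite setIUl; exact: elementaryU.
- elim: eY => [sigma' tau' os' ot'|A B _ IA _ IB]; last first.
  + by rewrite setIUr; exact: elementaryU.
  + rewrite (_ : _ `&` _ = [set p | maxe (sigma p.1) (sigma' p.1) <=
        p.2%:num%:E < mine (tau p.1) (tau' p.1)]).
      exact: elementary_itv (optional_time_max os os')
                            (optional_time_min ot ot').
    apply/seteqP; split=> p /=; rewrite ge_max lt_min.
      by case=> /andP[-> ->] /andP[-> ->].
    by case/andP=> /andP[-> ->] /andP[-> ->].
Qed.

(** The sections of [X] are finite unions of intervals that contain their left
    endpoints, so that the first visit to [X] after [S] is attained; over a
    single interval it is the maximum of [S] and the left endpoint, restricted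
    to the event that this precedes the right endpoint. *)
Lemma elementary_debut X S : elementary X -> optional_time F S ->
  exists D, [/\ optional_time F D, forall w, S w <= D w,
    graph_of_time D `<=` X &
    forall p, X p -> S p.1 <= p.2%:num%:E -> D p.1 <= p.2%:num%:E].
Proof.
move=> eX oS; elim: eX => [sigma tau os ot|A B _ [DA [oA SA gA dA]] _
    [DB [oB SB gB dB]]].
- pose rho w := maxe (sigma w) (S w).
  have orho : optional_time F rho by exact: optional_time_max.
  exists (fun w => if `[< rho w < tau w >] then rho w else +oo); split.
  + apply: (@optional_time_restrict rho [set w | rho w < tau w]) => // t.
    exact: optional_time_lt.
  + by move=> w; case: ifP => _; rewrite ?leey// le_max lexx orbT.
  + move=> [w t]; rewrite /graph_of_time/=; case: asboolP => //= rt e.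
    by move: (rt); rewrite -e => ->; rewrite le_max lexx.
  + move=> [w t] /= /andP[st tt] St; have rhot : rho w <= t%:num%:E.
      by rewrite ge_max st.
    by case: asboolP => // -[]; exact: le_lt_trans tt.
- exists (fun w => mine (DA w) (DB w)); split.
  + exact: optional_time_min.
  + by move=> w; rewrite le_min SA SB.
  + move=> [w t]; rewrite /graph_of_time/=.
    by case: (leP (DA w) (DB w)) => _ e; [left; apply: gA|right; apply: gB].
  + move=> p [Ap|Bp] Sp; rewrite ge_min.
      by rewrite dA.
    by rewrite dB ?orbT.
Qed.

End optional_times.

Section latest.
Variables (R : realType) (d : measure_display) (T : measurableType d).
Variables (P : probability T R) (F : {nonneg R} -> set (set T)).
Hypothesis filtF : is_filtration F.
Hypothesis Fmeas : forall t, F t `<=` measurable.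
Implicit Types (S tau D : T -> \bar R) (t : {nonneg R}).

Lemma measurable_optional_le S t : optional_time F S ->
  measurable [set w | S w <= t%:num%:E].
Proof. by move=> oS; apply: (Fmeas (t := t)); exact: oS.2. Qed.

Lemma measurable_optional_gt S t : optional_time F S ->
  measurable [set w | t%:num%:E < S w].
Proof.
move=> oS; rewrite (_ : [set _ | _] = ~` [set w | S w <= t%:num%:E]).
  by apply: measurableC; exact: measurable_optional_le.
by apply/seteqP; split=> w /=; rewrite ltNge => /negP.
Qed.

(** This is the essential supremum of the optional times that precede [B]; it
    stands in for the debut of [B], which need not be an optional time.  It is
    obtained by maximising the probability of exceeding each rational time. *)
Lemma latest_optional_time_before (B : set (T * {nonneg R})) :
  exists tau, [/\ optional_time F tau, B `<=` stochastic_interval tau &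
    forall S, optional_time F S -> B `<=` stochastic_interval S ->
      (forall w, tau w <= S w) -> P.-negligible [set w | tau w < S w]].
Proof.
pose before S := optional_time F S /\ B `<=` stochastic_interval S.
pose q := @rational_time R.
pose sup_exceed n := ereal_sup [set P [set w | (q n)%:num%:E < S w] | S in before].
have before0 : before (fun=> 0).
  split; first exact: optional_time_cst.
  by move=> p _; rewrite /stochastic_interval/= lee_fin.
have /choice[f fP] nk : exists S, before S /\
    sup_exceed nk.1 <= P [set w | (q nk.1)%:num%:E < S w] + (nk.2.+1%:R^-1)%:E.
  have fin : sup_exceed nk.1 \is a fin_num.
    rewrite ge0_fin_numE.
      apply: (@le_lt_trans _ _ 1); last exact: ltry.
      apply: ge_ereal_sup => _ [S [oS _] <-]; apply: probability_le1.
      exact: measurable_optional_gt.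
    apply: (@le_trans _ _ (P [set w | (q nk.1)%:num%:E < 0])) => //.
    by apply: ereal_sup_ubound; exists (fun=> 0).
  have k0 : (0 < nk.2.+1%:R^-1 :> R)%R by rewrite invr_gt0.
  have [_ [S bS <-] lt] := ub_ereal_sup_adherent k0 fin.
  exists S; split=> //; rewrite -leeBlDr//; exact: ltW.
pose dec m : nat * nat := odflt (0, 0)%N (unpickle m).
pose tau w := ereal_sup [set f (dec m) w | m in setT].
have f_le_tau p w : f p w <= tau w.
  by apply: ereal_sup_ubound; exists (pickle p) => //; rewrite /dec pickleK.
have otau : optional_time F tau.
  by apply: optional_time_sup => // m; have [[]] := fP (dec m).
exists tau; split=> //.
  move=> p Bp; apply: ge_ereal_sup => _ [m _ <-].
  by have [[_ h] _] := fP (dec m); exact: h.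
move=> S oS BS tauS.
(* [tau] already maximises the probability of exceeding [q n], so [S] cannot
   exceed [q n] with positive probability where [tau] does not. *)
have jump0 n : P.-negligible ([set w | (q n)%:num%:E < S w] `\`
    [set w | (q n)%:num%:E < tau w]).
  set E := [set w | _ < S w]; set E' := [set w | _ < tau w].
  have mE : measurable E by exact: measurable_optional_gt.
  have mE' : measurable E' by exact: measurable_optional_gt.
  have sE'E : E' `<=` E by move=> w /= h; exact: lt_le_trans (tauS w).
  have leE : P E <= P E'.
    apply/lee_addgt0Pr => e e0.
    (* so that [1 / (k + 1) < e] *)
    pose k := Num.truncn (e^-1).
    have [[_ _] le] := fP (n, k).
    have PE : P E <= sup_exceed n by apply: ereal_sup_ubound; exists S.
    apply: (le_trans PE); apply: (le_trans le); apply: leeD => /=.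
      apply: le_measure; rewrite ?inE//.
        by apply: measurable_optional_gt; have [[]] := fP (n, k).
      by move=> w /= h; apply: lt_le_trans (f_le_tau (n, k) w).
    rewrite lee_fin -[leRHS]invrK lef_pV2 ?posrE ?invr_gt0//.
    exact/ltW/truncnS_gt.
  apply/negligibleP; first exact: measurableD.
  rewrite measureD//; last by apply: le_lt_trans (probability_le1 P mE) (ltry _).
  rewrite setIidr//; apply/eqP; rewrite eq_le sube_le0 leE/=.
  by rewrite sube_ge0 ?fin_num_measure// le_measure ?inE.
apply: negligibleS (negligible_bigcup jump0) => w /= h.
have [n /andP[tn nS]] := rational_time_dense (otau.1 w) h.
by exists n => //; split => //=; apply/negP; rewrite -leNgt.
Qed.

End latest.

(** * Sets with compact sections *)

Lemma compact_nested (R : realType) (C : nat -> set R) :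
  (forall n, compact (C n)) -> (forall n, C n !=set0) ->
  (forall n p, (n <= p)%N -> C p `<=` C n) -> \bigcap_n C n !=set0.
Proof.
move=> cC C0 Cdecr; have := cC 0%N; rewrite compact_In0; apply.
  exists C => n _; first by apply: compact_closed => //; exact: Rhausdorff.
  by apply/esym/setIidPr; exact: Cdecr.
move=> D' _; have [x Cx] := C0 (\max_(i <- finmap.enum_fset D') i)%N.
exists x => i /= iD'.
by apply: Cdecr Cx; exact: leq_bigmax_seq.
Qed.

Section compact_sections.
Variables (R : realType) (d : measure_display) (T : measurableType d).
Implicit Types X Y : set (T * {nonneg R}).

Definition real_section X (w : T) : set R :=
  [set t%:num | t in [set t | X (w, t)]].

(** The section is constant on the blocks of a countable measurable partition,
    the fibres of [g]; this is what makes the projection measurable, also after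
    a finite union or intersection. *)
Definition compact_sections : set (set (T * {nonneg R})) :=
  [set X | (forall w, compact (real_section X w)) /\
    exists g : T -> nat, (forall n, measurable (g @^-1` [set n])) /\
      forall w w' t, g w = g w' -> X (w, t) -> X (w', t)].

(** A common refinement of two countable measurable partitions. *)
Lemma measurable_pickle_pair (g h : T -> nat) :
  (forall n, measurable (g @^-1` [set n])) ->
  (forall n, measurable (h @^-1` [set n])) ->
  forall n, measurable ((fun w => pickle (g w, h w)) @^-1` [set n]).
Proof.
move=> mg mh n; rewrite (_ : _ @^-1` _ =
  \bigcup_i \bigcup_(j in [set j | pickle (i, j) = n])
    (g @^-1` [set i] `&` h @^-1` [set j])).
  by apply: bigcup_measurable => i _; apply: bigcup_measurable => j _;
    exact: measurableI.
apply/seteqP; split=> w /=; first by move=> <-; exists (g w) => //; exists (h w).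
by case=> i _ [j /= <- [/= -> ->]].
Qed.

Lemma compact_sectionsU X Y :
  compact_sections X -> compact_sections Y -> compact_sections (X `|` Y).
Proof.
move=> [cX [g [mg gX]]] [cY [h [mh hY]]]; split=> [w|].
  rewrite (_ : real_section _ _ = real_section X w `|` real_section Y w).
    exact: compactU.
  by rewrite -image_setU.
exists (fun w => pickle (g w, h w)); split; first exact: measurable_pickle_pair.
move=> w w' t /(pcan_inj pickleK)[gw hw] [Xw|Yw]; first by left; exact: gX Xw.
by right; exact: hY Yw.
Qed.

Lemma compact_sectionsI X Y :
  compact_sections X -> compact_sections Y -> compact_sections (X `&` Y).
Proof.
move=> [cX [g [mg gX]]] [cY [h [mh hY]]]; split=> [w|].
  rewrite (_ : real_section _ _ = real_section X w `&` real_section Y w).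
    apply: compact_closedI => //.
    by apply: compact_closed => //; exact: Rhausdorff.
  apply/seteqP; split=> [_ [t [Xt Yt] <-]|_ [[t Xt <-] [t' Yt']]].
    by split; exists t.
  by move=> /val_inj tt'; exists t => //; split => //; rewrite /= -tt'.
exists (fun w => pickle (g w, h w)); split; first exact: measurable_pickle_pair.
move=> w w' t /(pcan_inj pickleK)[gw hw] [Xw Yw].
by split; [exact: gX Xw|exact: hY Yw].
Qed.

Lemma compact_sections_rect (E : set T) (a b : R) : measurable E ->
  compact_sections [set p | E p.1 /\ (a <= p.2%:num <= b)%R].
Proof.
move=> mE; split=> [w|].
  have [Ew|Ew] := pselect (E w); last first.
    rewrite (_ : real_section _ _ = set0); first exact: compact0.
    by apply/seteqP; split=> // x [t []].
  rewrite (_ : real_section _ _ = `[Num.max a 0%R, b]%classic).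
    exact: segment_compact.
  apply/seteqP; split=> [_ [t [_ /andP[la lb]] <-]|x] /=.
    by rewrite in_itv/= ge_max la lb/= andbT.
  rewrite in_itv/= ge_max => /andP[/andP[la l0] lb].
  by exists (NngNum l0) => //=; split => //; rewrite la lb.
exists (fun w => nat_of_bool `[< E w >]); split=> [n|w w' t /=]; last first.
  by move=> + [Ew tab]; rewrite (asboolT Ew); case: asboolP.
case: n => [|[|n]].
- rewrite (_ : _ @^-1` _ = ~` E); first exact: measurableC.
  by apply/seteqP; split=> w /=; case: asboolP.
- rewrite (_ : _ @^-1` _ = E)//.
  by apply/seteqP; split=> w /=; case: asboolP.
- by rewrite (_ : _ @^-1` _ = set0)//; apply/seteqP; split=> w //=; case: asboolP.
Qed.

Lemma measurable_compact_sections_proj X :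
  compact_sections X -> measurable (fst @` X).
Proof.
move=> [_ [g [mg gX]]]; rewrite (_ : _ @` _ =
    \bigcup_(n in [set g p.1 | p in X]) (g @^-1` [set n])).
  by apply: bigcup_measurable.
apply/seteqP; split=> w /=.
  by case=> -[w' t] Xw /= <-; exists (g w') => //; exists (w', t).
case=> _ [[w' t] Xw /= <-] /= gw; exists (w, t) => //; exact: gX Xw.
Qed.

(** The section of the intersection over a given point is a decreasing
    intersection of nonempty compact sets. *)
Lemma bigcap_compact_sections_proj (X : nat -> set (T * {nonneg R})) :
  (forall n, compact_sections (X n)) ->
  (forall n p, (n <= p)%N -> X p `<=` X n) ->
  fst @` (\bigcap_n X n) = \bigcap_n (fst @` X n).
Proof.
move=> cX Xdecr; apply/seteqP; split=> w.
  by case=> p Xp <- n _; exists p => //; exact: Xp.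
move=> Xw; have [||n p np|x Xx] := @compact_nested R (fun n => real_section (X n) w).
- by move=> n; have [] := cX n.
- move=> n; have [[w' t] Xt /= ww'] := Xw n I.
  by exists t%:num; exists t => //=; rewrite -ww'.
- by move=> _ [t Xt <-]; exists t => //=; exact: Xdecr Xt.
have [t _ tx] := Xx 0%N I.
exists (w, t) => // n _; have [t' Xt'] := Xx n I.
by rewrite -tx => /val_inj <-.
Qed.

End compact_sections.

(** * Optional sets are Souslin *)

Section optional_souslin.
Variables (R : realType) (d : measure_display) (T : measurableType d).
Variable F : {nonneg R} -> set (set T).
Hypothesis filtF : is_filtration F.
Hypothesis Fmeas : forall t, F t `<=` measurable.
Implicit Types tau : T -> \bar R.

(** A time precedes [tau] when some rational time separates the two. *)
Lemma souslin_before tau : optional_time F tau ->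
  souslin_pair (@compact_sections R _ T) setT
    [set p | p.2%:num%:E < tau p.1].
Proof.
move=> otau; pose q := @rational_time R.
rewrite (_ : [set _ | _] = \bigcup_n [set p |
    [set w | (q n)%:num%:E < tau w] p.1 /\ (0 <= p.2%:num <= (q n)%:num)%R]).
  apply: souslin_pair_bigcup => n; apply: souslin_pair_paving.
  apply: compact_sections_rect; exact: measurable_optional_gt otau.
apply/seteqP; split=> -[w t] /=.
  move=> lt; have [|n /andP[tn nt]] := rational_time_dense _ lt.
    by rewrite lee_fin.
  by exists n => //=; split=> //; rewrite ge0.
by case=> n _ /= [+ /andP[_ tq]]; apply: le_lt_trans; rewrite lee_fin.
Qed.

(** A time [t] is at least [tau] when no rational [q] satisfies
    [t <= q < tau], that is, for every [q], either [q < t] or [tau <= q]; the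
    index [m] exhausts these two unbounded conditions by rectangles with compact
    sides. *)
Lemma souslin_after tau : optional_time F tau ->
  souslin_pair (@compact_sections R _ T) setT (stochastic_interval tau).
Proof.
move=> otau; pose q := @rational_time R.
rewrite (_ : stochastic_interval tau = \bigcap_n \bigcup_m
  ([set p | setT p.1 /\ ((q n)%:num + m.+1%:R^-1 <= p.2%:num <= m.+1%:R)%R] `|`
   [set p | [set w | tau w <= (q n)%:num%:E] p.1 /\
            (0 <= p.2%:num <= m.+1%:R)%R])).
  apply: souslin_pair_bigcap => n; apply: souslin_pair_bigcup => m.
  apply: souslin_pair_paving; apply: compact_sectionsU.
    exact: compact_sections_rect.
  apply: compact_sections_rect; exact: measurable_optional_le otau.
apply/seteqP; split=> -[w t] /=.
  rewrite /stochastic_interval/= => tt n _.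
  have [qt|tq] := ltP (q n)%:num t%:num; last first.
    exists (Num.truncn t%:num) => //; right; split=> /=.
      by apply: le_trans tt _; rewrite lee_fin.
    by rewrite ge0//= ltW// truncnS_gt.
  have tq0 : (0 < t%:num - (q n)%:num :> R)%R by rewrite subr_gt0.
  set x := (t%:num - (q n)%:num)%R in tq0.
  exists (Num.truncn (x^-1 + t%:num)%R) => //; left; split=> //=.
  have h := truncnS_gt (x^-1 + t%:num)%R.
  have x0 : (0 < x^-1)%R by rewrite invr_gt0.
  apply/andP; split; last by apply/ltW/(le_lt_trans _ h); rewrite lerDr ltW.
  rewrite -lerBrDl -/x -[leRHS]invrK lef_pV2 ?posrE//.
  by apply/ltW/(le_lt_trans _ h); rewrite lerDl.
move=> h; rewrite /stochastic_interval/= leNgt; apply/negP => lt.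
have [|n /andP[tn nt]] := rational_time_dense _ lt; first by rewrite lee_fin.
have [m _ [[_ /= /andP[qt _]]|[/= tq _]]] := h n I.
  move: tn; rewrite lee_fin leNgt => /negP; apply.
  by apply: lt_le_trans qt; rewrite ltrDl.
by move: nt; rewrite ltNge tq.
Qed.

(** The sets that have a pair of schemes together with their complement form a
    sigma-algebra, which contains the generators: [[tau, +oo[[ and its
    complement [[0, tau[[ are both elementary. *)
Lemma optional_souslin (O : set (T * {nonneg R})) :
  optional_sigma_algebra F O ->
  souslin_pair (@compact_sections R _ T) (elementary F) O.
Proof.
pose C := [set X | souslin_pair (@compact_sections R _ T) (elementary F) X /\
                   souslin_pair (@compact_sections R _ T) (elementary F) (~` X)].
suff : optional_sigma_algebra F `<=` C by move=> h /h[].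
have oinfty : optional_time F (fun=> +oo) by exact: optional_time_cst.
have o0 : optional_time F (fun=> 0) by exact: optional_time_cst.
have gen tau : optional_time F tau -> C (stochastic_interval tau).
  move=> otau; split.
    apply: souslin_pair_outer (souslin_after otau).
    rewrite (_ : stochastic_interval tau =
        [set p | tau p.1 <= p.2%:num%:E < +oo]).
      exact: elementary_itv otau oinfty.
    by apply/seteqP; split=> p /=; rewrite ltry andbT.
  rewrite (_ : ~` _ = [set p | p.2%:num%:E < tau p.1]).
    apply: souslin_pair_outer (souslin_before otau).
    rewrite (_ : [set _ | _] = [set p | 0 <= p.2%:num%:E < tau p.1]).
      exact: elementary_itv o0 otau.
    by apply/seteqP; split=> p /=; rewrite lee_fin ge0.
  by apply/seteqP; split=> p; rewrite /stochastic_interval/= ltNge => /negP.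
apply: smallest_sub; last by move=> _ [tau otau <-]; exact: gen.
split.
- have -> : set0 = stochastic_interval (fun=> +oo) :> set (T * {nonneg R}).
    by apply/seteqP; split => // p; rewrite /stochastic_interval/= leye_eq.
  exact: gen.
- by move=> A [sA sA']; rewrite setTD; split; rewrite ?setCK.
- move=> A CA; split; first by apply: souslin_pair_bigcup => n; have [] := CA n.
  by rewrite setC_bigcup; apply: souslin_pair_bigcap => n; have [] := CA n.
Qed.

End optional_souslin.

(** * Outer probability *)

Section outer_probability.
Variables (R : realType) (d : measure_display) (T : measurableType d).
Variable P : probability T R.
Implicit Types A B : set T.

Lemma outer_probability_le A B :
  A `<=` B -> measurable B -> outer_probability P A <= P B.
Proof. by move=> AB mB; apply: ereal_inf_lbound; exists B. Qed.

Lemma le_outer_probability A B :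
  A `<=` B -> outer_probability P A <= outer_probability P B.
Proof.
move=> AB; apply: ereal_inf_le_tmp.
by move=> _ [E [BE mE] <-]; exists E => //; split => //; exact: subset_trans BE.
Qed.

Lemma outer_probability_fin_num A : outer_probability P A \is a fin_num.
Proof.
rewrite ge0_fin_numE.
  apply: (@le_lt_trans _ _ (P setT)); first exact: outer_probability_le.
  by rewrite probability_setT ltry.
by apply: le_ereal_inf_tmp => _ [E _ <-].
Qed.

(** If [E n] is a measurable cover of [A n] with small excess, then so are the
    sets [\bigcap_(k >= n) E k]; these increase with [n], so that the
    continuity of [P] applies to them. *)
Lemma outer_probability_bigcup (A : nat -> set T) (a : \bar R) :
  (forall n p, (n <= p)%N -> A n `<=` A p) ->
  (forall n, outer_probability P (A n) <= a) ->
  outer_probability P (\bigcup_n A n) <= a.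
Proof.
move=> Aincr Aa; apply/lee_addgt0Pr => e e0.
have /choice[E EP] n : exists E,
    [/\ A n `<=` E, measurable E & P E <= a + e%:E].
  have : outer_probability P (A n) < outer_probability P (A n) + e%:E.
    by rewrite lteDl ?outer_probability_fin_num// lte_fin.
  move=> /ereal_inf_lt[_ [E [AE mE] <-] lt]; exists E; split=> //.
  by apply: (le_trans (ltW lt)); rewrite leeD2r.
pose D n := \bigcap_(k in [set k | (n <= k)%N]) E k.
have mE n : measurable (E n) by have [] := EP n.
have mD n : measurable (D n) by exact: bigcap_measurableType.
have mUD : measurable (\bigcup_n D n) by exact: bigcup_measurable.
have cvgD : P (D n) @[n --> \oo] --> P (\bigcup_n D n).
  apply: nondecreasing_cvg_mu => // n p np; apply/subsetPset => w Dw k /= pk.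
  by apply: Dw => /=; exact: leq_trans pk.
apply: (@le_trans _ _ (P (\bigcup_n D n))).
  apply: outer_probability_le => // w [n _ Aw]; exists n => // k /= nk.
  by have [AE _ _] := EP k; apply/AE/(Aincr n).
rewrite -(cvg_lim _ cvgD)//; apply: lime_le; first by apply/cvg_ex; eexists; exact: cvgD.
apply: nearW => n; have [_ _] := EP n; apply: le_trans.
by apply: le_measure; rewrite ?inE// => w; apply => /=.
Qed.

End outer_probability.

(** * The section theorem *)

(** The optional time [sigma] that is latest before [\bigcap_n X n] almost surely
    coincides with the debuts after [sigma] of all the [X n], since these also
    precede the intersection.  Where it does, it lies in every [X n]; elsewhere
    it is sent to infinity. *)
Lemma elementary_bigcap_section (R : realType) (d : measure_display)
    (T : measurableType d) (P : probability T R)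
    (F : {nonneg R} -> set (set T)) (X : nat -> set (T * {nonneg R})) :
  is_filtration F -> (forall t, F t `<=` measurable) ->
  (forall n, elementary F (X n)) ->
  exists tau, [/\ optional_time F tau, graph_of_time tau `<=` \bigcap_n X n &
    P.-negligible (fst @` (\bigcap_n X n) `\` [set w | tau w < +oo])].
Proof.
move=> filtF Fmeas eX.
have [sigma [osigma Bsigma latest]] :=
  latest_optional_time_before P filtF Fmeas (\bigcap_n X n).
have /choice[D DP] n := elementary_debut filtF (eX n) osigma.
pose E := [set w | forall n, sigma w = D n w].
exists (fun w => if `[< E w >] then sigma w else +oo); split.
- apply: optional_time_restrict => // t.
  rewrite (_ : _ `&` _ = [set w | sigma w <= t%:num%:E] `\`
      \bigcup_n [set w | sigma w < D n w /\ sigma w <= t%:num%:E]).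
    rewrite (filtration_measurable filtF); apply: measurableD.
      by rewrite -(filtration_measurable filtF); exact: osigma.2.
    apply: bigcup_measurable => n _; rewrite -(filtration_measurable filtF).
    by apply: optional_time_lt => //; have [] := DP n.
  apply/seteqP; split=> w /=.
    by move=> [Ew st]; split=> // -[n _ [/=]]; rewrite -(Ew n) ltxx.
  move=> [st nD]; split=> // n; apply/eqP; rewrite eq_le.
  have [_ -> _ _] := DP n => /=; rewrite leNgt; apply/negP => lt.
  by apply: nD; exists n.
- move=> [w t]; rewrite /graph_of_time/=; case: asboolP => // Ew sw n _.
  by have [_ _ + _] := DP n; apply; rewrite /graph_of_time/= -(Ew n).
- have late n : P.-negligible [set w | sigma w < D n w].
    have [oD sD _ dD] := DP n; apply: latest => // p Xp.
    by apply: dD; [exact: Xp|exact: Bsigma].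
  apply: negligibleS (negligible_bigcup late) => _ [[[w t] Xp <-]] /=.
  case: asboolP => [_|nE _].
    by case; exact: le_lt_trans (Bsigma _ Xp) (ltry _).
  apply: contrapT => nD; apply: nE => n; apply/eqP; rewrite eq_le.
  have [_ -> _ _] := DP n => /=; rewrite leNgt; apply/negP => lt.
  by apply: nD; exists n.
Qed.

Theorem theorem3p9 (R : realType) (d : measure_display)
    (Omega : measurableType d) (P : probability Omega R)
    (F : {nonneg R} -> set (set Omega))
    (filtF : is_filtration F)
    (FP : <<s \bigcup_(t in [set: {nonneg R}]) F t >> `<=` measurable)
    (O : set (Omega * {nonneg R})) (optO : optional_sigma_algebra F O)
    (eps : R) (eps_gt0 : (0 < eps)%R) :
  exists tau : Omega -> \bar R,
    [/\ optional_time F tau,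
        graph_of_time tau `<=` O &
        outer_probability P (fst @` O) - P [set w | tau w < +oo] <= eps%:E].
Proof.
have Fmeas t : F t `<=` measurable.
  by move=> E FE; apply: FP; apply: sub_sigma_algebra; exists t.
have [G [H [[naG KG] [naH eH] GH OG HO]]] := optional_souslin filtF Fmeas optO.
(* The outer probability is finite, so lowering it by [eps] makes it a strict
   threshold, which the projection of [O] itself exceeds. *)
pose a := outer_probability P (fst @` O) - eps%:E.
pose Big (X : set (Omega * {nonneg R})) := a < outer_probability P (fst @` X).
have [m Gm] : exists m, forall n, Big (bounded_hull G m n).
  apply: (@capacitability _ Big G) => //.
  - move=> X Y XY; rewrite /Big => /lt_le_trans; apply.
    by apply: le_outer_probability; exact: image_subset.
  - move=> X Xincr; rewrite /Big image_bigcup => lt.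
    apply: contrapT => /forallNP h; move: lt; rewrite ltNge => /negP; apply.
    apply: outer_probability_bigcup => [n p np|n].
      by apply: image_subset; exact: Xincr.
    by rewrite leNgt; apply/negP; exact: h.
  - apply: (@lt_le_trans _ _ (outer_probability P (fst @` O))).
      by rewrite lteBlDr// lteDl ?lte_fin// outer_probability_fin_num.
    by apply: le_outer_probability; exact: image_subset.
pose X := bounded_hull H m.
pose Y := bounded_hull G m.
have KY n : compact_sections (Y n).
  apply: bounded_hull_paving => //.
  - exact: compact_sectionsU.
  - exact: compact_sectionsI.
have eX n : elementary F (X n).
  apply: bounded_hull_paving => //.
  - exact: elementaryU.
  - exact: elementaryI.
have YX : \bigcap_n Y n `<=` \bigcap_n X n.
  move=> x /(bigcap_bounded_hull naG)[s sm /GH Hx] n _.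
  by exists s => // k _; exact: Hx.
have XO : \bigcap_n X n `<=` O.
  by move=> x /(bigcap_bounded_hull naH)[s _ Hx]; apply: HO; exists s.
have [tau [otau tauX negl]] := elementary_bigcap_section P filtF Fmeas eX.
exists tau; split => //; first exact: subset_trans XO.
have mtau : measurable [set w | tau w < +oo].
  rewrite (_ : [set _ | _] =
      \bigcup_n [set w | tau w <= (rational_time R n)%:num%:E]).
    apply: bigcup_measurable => n _; exact: (measurable_optional_le Fmeas).
  apply/seteqP; split=> w /=.
    by move=> /(rational_time_dense (otau.1 w))[n /andP[tn _]]; exists n.
  by case=> n _ /= /le_lt_trans; apply; exact: ltry.
have mY n : measurable (fst @` Y n) by exact: measurable_compact_sections_proj.
have mYcap : measurable (\bigcap_n (fst @` Y n)) by exact: bigcap_measurableType.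
have Ydecr n p : (n <= p)%N -> Y p `<=` Y n by exact: bounded_hull_decr.
have aY : a <= P (fst @` (\bigcap_n Y n)).
  rewrite bigcap_compact_sections_proj//.
  have cvgY : P (fst @` Y n) @[n --> \oo] --> P (\bigcap_n (fst @` Y n)).
    apply: nonincreasing_cvg_mu => //.
      by apply: le_lt_trans (probability_le1 P (mY _)) (ltry _).
    by move=> n p np; apply/subsetPset; apply: image_subset; exact: Ydecr.
  rewrite -(cvg_lim _ cvgY)//; apply: lime_ge.
    by apply/cvg_ex; eexists; exact: cvgY.
  apply: nearW => n; apply: (le_trans (ltW (Gm n))).
  exact: outer_probability_le.
have mZ : measurable (fst @` (\bigcap_n Y n)).
  by rewrite bigcap_compact_sections_proj.
suff le_tau : P (fst @` (\bigcap_n Y n)) <= P [set w | tau w < +oo].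
  by rewrite leeBlDl ?fin_num_measure// -leeBlDr// (le_trans aY).
set Z := _ @` _ in mZ *; set E := [set w | _ < _] in mtau negl *.
have ZE0 : P (Z `\` E) = 0.
  apply/negligibleP; first exact: measurableD.
  by apply: negligibleS negl; apply: setSD; exact: image_subset.
apply: (@le_trans _ _ (P (E `|` (Z `\` E)))).
  apply: le_measure; rewrite ?inE//.
    by apply: measurableU => //; exact: measurableD.
  by move=> w Zw; have [?|?] := pselect (E w); [left|right].
rewrite -[leRHS]adde0 -[in leRHS]ZE0.
by apply: measureU2 => //; exact: measurableD.
Qed.
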